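(* The associative Lambek calculus is sound in the class of frames in $\mathbb{LK}$ satisfying the association constraints (A) (hence also in the class of frames in $\mathbb{LK}^*$ satisfying (A$^*$) and in the class of frames in $\mathbb{LK}_*$ satisfying (A$_*$)): every provable sequent $\varphi\vdash\psi$ satisfies $[\![\varphi]\!]_{\mathfrak{M}}\subseteq[\![\psi]\!]_{\mathfrak{M}}$ in every model on a frame of the class. It is complete in the class of frames in $\mathbb{LK}_*$ satisfying (A$_*$) (hence also in the class of frames in $\mathbb{LK}^*$ satisfying (A$^*$) and in the class of frames in $\mathbb{LK}$ satisfying (A)): every sequent valid in all models on frames of the class is provable.
   Context: Logic. Sentences: $\varphi::=p_i\,(i\in\mathbb{N})\mid\top\mid\mathtt{t}\mid\varphi\leftarrow\varphi\mid\varphi\circ\varphi\mid\varphi\to\varphi$. The non-associative Lambek calculus: sequents $\varphi\vdash\psi$ generated by $\varphi\vdash\varphi$; $\varphi\vdash\top$; cut; uniform substitution; two-way rules $\varphi\vdash\vartheta\leftarrow\psi$ iff $\varphi\circ\psi\vdash\vartheta$ iff $\psi\vdash\varphi\to\vartheta$; and $\mathtt{t}\circ\varphi\vdash\varphi$, $\varphi\vdash\mathtt{t}\circ\varphi$, $\varphi\circ\mathtt{t}\vdash\varphi$, $\varphi\vdash\varphi\circ\mathtt{t}$. The associative calculus adds $\varphi\circ(\psi\circ\vartheta)\vdash(\varphi\circ\psi)\circ\vartheta$ and $(\varphi\circ\psi)\circ\vartheta\vdash\varphi\circ(\psi\circ\vartheta)$. Frames. $\mathfrak{F}=(W_1,W_\partial,I,U,S,R,T)$: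 $W_1,W_\partial$ nonempty sets (not necessarily disjoint), $I\subseteq W_1\times W_\partial$, $U\subseteq W_1$, $S\subseteq W_\partial\times(W_\partial\times W_1)$, $R\subseteq W_1\times(W_1\times W_1)$, $T\subseteq W_\partial\times(W_1\times W_\partial)$. Let $\perp$ be the complement of $I$; $A'=\{y\in W_\partial\mid\forall x\in A\;x\perp y\}$ for $A\subseteq W_1$, $B'=\{x\in W_1\mid\forall y\in B\;x\perp y\}$ for $B\subseteq W_\partial$. Galois sets: $G=G''$ (stable in $W_1$, co-stable in $W_\partial$). On each sort, $u\leq w$ iff $\{u\}'\subseteq\{w\}'$. For $Q\in\{S,R,T\}$, $Quw=\{z\mid zQuw\}$, and its Galois dual $Q'$ is given by $zQ'uw$ iff $z\in(Quw)'$. In the following $x,z,u,w,z_i,\hat z_i,v_1$ (and $v$ in (A)) range over $W_1$ and $y,y_1$ (and $v$ in (F1), (RES)) over $W_\partial$. $\mathbb{LK}$: (F1) all sections $Txv$, $Rxz$, $Svx$ are Galois sets; (RES) $xS'vz$ iff $vR'xz$ iff $zT'xv$, for all $x,z,v$; (U$^*$) $U$ is Galois stable; (F2.1) $xRz_1z_2$ and $z_1\in U$ imply $z_2\leq x$; (F2.2) $xRz_1z_2$ and $z_2\in U$ imply $z_1\leq x$; (F3.1) $\forall x\forall y(xIy\to\exists z(zIy\wedge\exists z_1,z_2(z_1\in U\wedge zRz_1z_2\wedge x\leq z_2)))$; (F3.2) $\forall x\forall y(xIy\to\exists z(zIy\wedge\exists z_1,z_2(z_2\in U\wedge zRz_1z_2\wedge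 x\leq z_1)))$. $\mathbb{LK}^*$: as $\mathbb{LK}$ with (F3.1),(F3.2) replaced by $\forall x\exists z_1,z_2(z_1\in U\wedge xRz_1z_2\wedge x\leq z_2)$ and $\forall x\exists z_1,z_2(z_2\in U\wedge xRz_1z_2\wedge x\leq z_1)$. $\mathbb{LK}_*$: as $\mathbb{LK}$ with (F3.1),(F3.2) replaced by $\forall x\exists z(z\in U\wedge xRzx)$ and $\forall x\exists z(z\in U\wedge xRxz)$, and with the additional axiom (M): for any $y\in W_\partial$, $x\in W_1$ the binary relations $yT$, $xR$, $yS$ are decreasing in both argument places with respect to $\leq$. Association constraints (for all $x,z_1,z_2,z_3$): (A) consists of the two conditions: (i) $\exists u(xRz_1u\wedge uRz_2z_3)\to\forall y[xIy\to\exists w(wIy\wedge\exists v_1\exists\hat z_3(wRv_1\hat z_3\wedge z_3\leq\hat z_3\wedge\forall y_1(v_1Iy_1\to\exists v(vIy_1\wedge\exists\hat z_1\exists\hat z_2(vR\hat z_1\hat z_2\wedge z_1\leq\hat z_1\wedge z_2\leq\hat z_2)))))]$; (ii) $\exists u(xRuz_3\wedge uRz_1z_2)\to\forall y[xIy\to\exists w(wIy\wedge\exists\hat z_1\exists v_1(wR\hat z_1v_1\wedge z_1\leq\hat z_1\wedge\forall y_1(v_1Iy_1\to\exists v(vIy_1\wedge\exists\hat z_2\exists\hat z_3(z_2\leq\hat z_2\wedge z_3\leq\hat z_3\wedge vR\hat z_2\hat z_3)))))]$. (A$^*$): $\exists u(xRz_1u\wedge uRz_2z_3)\to\exists u,\hat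 z_1,\hat z_2,\hat z_3(\bigwedge_i z_i\leq\hat z_i\wedge xRu\hat z_3\wedge uR\hat z_1\hat z_2)$, and $\exists u(xRuz_3\wedge uRz_1z_2)\to\exists u,\hat z_1,\hat z_2,\hat z_3(\bigwedge_i z_i\leq\hat z_i\wedge xR\hat z_1u\wedge uR\hat z_2\hat z_3)$. (A$_*$): $\exists u(xRz_1u\wedge uRz_2z_3)$ iff $\exists u(uRz_1z_2\wedge xRuz_3)$. Models. $V$ assigns a Galois stable set to each $p_i$. $[\![p_i]\!]=V(p_i)$, $[\![\top]\!]=W_1$, $[\![\mathtt{t}]\!]=U$, and $[\![\varphi\to\psi]\!]=\{z\in W_1\mid\forall x\in[\![\varphi]\!]\forall v\in[\![\psi]\!]'\;zT'xv\}$, $[\![\varphi\circ\psi]\!]=\{v\in W_\partial\mid\forall x\in[\![\varphi]\!]\forall z\in[\![\psi]\!]\;vR'xz\}'$, $[\![\psi\leftarrow\varphi]\!]=\{x\in W_1\mid\forall z\in[\![\varphi]\!]\forall v\in[\![\psi]\!]'\;xS'vz\}$. *)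

(* Defs.v *)
From mathcomp Require Import ssreflect ssrfun ssrbool boolp classical_sets.

Set Implicit Arguments.
Unset Strict Implicit.
Unset Printing Implicit Defensive.

Local Open Scope classical_set_scope.

Inductive form : Type :=
| fvar (i : nat)
| ftop
| funit
| flres (phi psi : form)   (* phi <- psi *)
| fcirc (phi psi : form)
| frres (phi psi : form).  (* phi -> psi *)

Declare Scope form_scope.
Delimit Scope form_scope with form.
Bind Scope form_scope with form.
Notation "a <~ b" := (flres a b) (at level 60, no associativity) : form_scope.
Notation "a ** b" := (fcirc a b) (at level 50, no associativity) : form_scope.
Notation "a ~> b" := (frres a b) (at level 60, no associativity) : form_scope.

Fixpoint fsubst (s : nat -> form) (phi : form) : form :=
  match phi with
  | fvar i => s i
  | ftop => ftop
  | funit => funit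
  | flres a b => flres (fsubst s a) (fsubst s b)
  | fcirc a b => fcirc (fsubst s a) (fsubst s b)
  | frres a b => frres (fsubst s a) (fsubst s b)
  end.

Reserved Notation "a |-- b" (at level 70, no associativity).

Inductive provable : form -> form -> Prop :=
| prov_id phi : phi |-- phi
| prov_top phi : phi |-- ftop
| prov_cut phi psi theta : phi |-- psi -> psi |-- theta -> phi |-- theta
| prov_subst s phi psi : phi |-- psi -> fsubst s phi |-- fsubst s psi
| prov_lresI phi psi theta : phi ** psi |-- theta -> phi |-- theta <~ psi
| prov_lresE phi psi theta : phi |-- theta <~ psi -> phi ** psi |-- theta
| prov_rresI phi psi theta : phi ** psi |-- theta -> psi |-- phi ~> theta
| prov_rresE phi psi theta : psi |-- phi ~> theta -> phi ** psi |-- theta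
| prov_unitlE phi : funit ** phi |-- phi
| prov_unitlI phi : phi |-- funit ** phi
| prov_unitrE phi : phi ** funit |-- phi
| prov_unitrI phi : phi |-- phi ** funit
| prov_assocl phi psi theta :
    phi ** (psi ** theta) |-- (phi ** psi) ** theta
| prov_assocr phi psi theta :
    (phi ** psi) ** theta |-- phi ** (psi ** theta)
where "a |-- b" := (provable a%form b%form).

(* The two sorts are types, so no (non-)disjointness question arises; both may
   be instantiated by the same type.  [relR x u w] is written x R u w: the first
   argument is the one that ranges over a section. *)
Record frame : Type := Frame {
  W1 : Type;
  Wd : Type;
  W1_nonempty : inhabited W1;
  Wd_nonempty : inhabited Wd;
  inc : W1 -> Wd -> Prop;
  frU : set W1;
  relS : Wd -> Wd -> W1 -> Prop;
  relR : W1 -> W1 -> W1 -> Prop;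
  relT : Wd -> W1 -> Wd -> Prop
}.

Definition perp (F : frame) (x : W1 F) (y : Wd F) : Prop := ~ inc x y.

(* The two halves A |-> A' and B |-> B' of the Galois connection. *)
Definition polar1 (F : frame) (A : set (W1 F)) : set (Wd F) :=
  [set y | forall x, A x -> perp x y].
Definition polard (F : frame) (B : set (Wd F)) : set (W1 F) :=
  [set x | forall y, B y -> perp x y].

Definition stable (F : frame) (A : set (W1 F)) : Prop :=
  A = polard (polar1 A).
Definition costable (F : frame) (B : set (Wd F)) : Prop :=
  B = polar1 (polard B).

Definition le1 (F : frame) (u w : W1 F) : Prop :=
  polar1 [set u] `<=` polar1 [set w].
Definition led (F : frame) (u w : Wd F) : Prop :=
  polard [set u] `<=` polard [set w].

Definition secS (F : frame) (v : Wd F) (x : W1 F) : set (Wd F) :=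
  [set y | relS y v x].
Definition secR (F : frame) (x z : W1 F) : set (W1 F) :=
  [set u | relR u x z].
Definition secT (F : frame) (x : W1 F) (v : Wd F) : set (Wd F) :=
  [set y | relT y x v].

(* The Galois dual relations S', R', T'. *)
Definition dualS (F : frame) (x : W1 F) (v : Wd F) (z : W1 F) : Prop :=
  polard (secS v z) x.
Definition dualR (F : frame) (v : Wd F) (x z : W1 F) : Prop :=
  polar1 (secR x z) v.
Definition dualT (F : frame) (z x : W1 F) (v : Wd F) : Prop :=
  polard (secT x v) z.

Definition F1 (F : frame) : Prop :=
  [/\ forall (x : W1 F) (v : Wd F), costable (secT x v),
      forall x z : W1 F, stable (secR x z)
    & forall (v : Wd F) (x : W1 F), costable (secS v x)].

Definition RES (F : frame) : Prop :=
  forall (x z : W1 F) (v : Wd F),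
    (dualS x v z <-> dualR v x z) /\ (dualR v x z <-> dualT z x v).

Definition Ustable (F : frame) : Prop := stable (@frU F).

Definition F21 (F : frame) : Prop :=
  forall x z1 z2 : W1 F, relR x z1 z2 -> frU z1 -> le1 z2 x.
Definition F22 (F : frame) : Prop :=
  forall x z1 z2 : W1 F, relR x z1 z2 -> frU z2 -> le1 z1 x.

Definition F31 (F : frame) : Prop :=
  forall (x : W1 F) (y : Wd F), inc x y ->
    exists z, inc z y /\ exists z1 z2, [/\ frU z1, relR z z1 z2 & le1 x z2].
Definition F32 (F : frame) : Prop :=
  forall (x : W1 F) (y : Wd F), inc x y ->
    exists z, inc z y /\ exists z1 z2, [/\ frU z2, relR z z1 z2 & le1 x z1].

Definition F31_up (F : frame) : Prop :=
  forall x : W1 F, exists z1 z2, [/\ frU z1, relR x z1 z2 & le1 x z2].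
Definition F32_up (F : frame) : Prop :=
  forall x : W1 F, exists z1 z2, [/\ frU z2, relR x z1 z2 & le1 x z1].

Definition F31_low (F : frame) : Prop :=
  forall x : W1 F, exists z, frU z /\ relR x z x.
Definition F32_low (F : frame) : Prop :=
  forall x : W1 F, exists z, frU z /\ relR x x z.

Definition decreasing2 (A B : Type) (leA : A -> A -> Prop) (leB : B -> B -> Prop)
    (Q : A -> B -> Prop) : Prop :=
  (forall a a' b, leA a' a -> Q a b -> Q a' b) /\
  (forall a b b', leB b' b -> Q a b -> Q a b').

Definition monM (F : frame) : Prop :=
  [/\ forall y : Wd F, decreasing2 (@le1 F) (@led F) (relT y),
      forall x : W1 F, decreasing2 (@le1 F) (@le1 F) (relR x)
    & forall y : Wd F, decreasing2 (@led F) (@le1 F) (relS y)].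

(* [LK], [LK_up] and [LK_low] are the classes LK, LK^* and LK_*; likewise
   [assocA], [assocA_up] and [assocA_low] are (A), (A^* ) and (A_* ). *)
Definition LKbase (F : frame) : Prop :=
  [/\ F1 F, RES F, Ustable F, F21 F & F22 F].

Definition LK (F : frame) : Prop := [/\ LKbase F, F31 F & F32 F].
Definition LK_up (F : frame) : Prop := [/\ LKbase F, F31_up F & F32_up F].
Definition LK_low (F : frame) : Prop :=
  [/\ LKbase F, F31_low F, F32_low F & monM F].

Definition assocA_i (F : frame) : Prop :=
  forall x z1 z2 z3 : W1 F,
    (exists u, relR x z1 u /\ relR u z2 z3) ->
    forall y, inc x y ->
      exists w, inc w y /\
        exists v1 z3', [/\ relR w v1 z3', le1 z3 z3' &
          forall y1, inc v1 y1 ->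
            exists v, inc v y1 /\
              exists z1' z2', [/\ relR v z1' z2', le1 z1 z1' & le1 z2 z2']].

Definition assocA_ii (F : frame) : Prop :=
  forall x z1 z2 z3 : W1 F,
    (exists u, relR x u z3 /\ relR u z1 z2) ->
    forall y, inc x y ->
      exists w, inc w y /\
        exists z1' v1, [/\ relR w z1' v1, le1 z1 z1' &
          forall y1, inc v1 y1 ->
            exists v, inc v y1 /\
              exists z2' z3', [/\ le1 z2 z2', le1 z3 z3' & relR v z2' z3']].

Definition assocA (F : frame) : Prop := assocA_i F /\ assocA_ii F.

Definition assocA_up (F : frame) : Prop :=
  (forall x z1 z2 z3 : W1 F,
     (exists u, relR x z1 u /\ relR u z2 z3) ->
     exists u z1' z2' z3',
       [/\ le1 z1 z1', le1 z2 z2', le1 z3 z3', relR x u z3' & relR u z1' z2'])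
  /\
  (forall x z1 z2 z3 : W1 F,
     (exists u, relR x u z3 /\ relR u z1 z2) ->
     exists u z1' z2' z3',
       [/\ le1 z1 z1', le1 z2 z2', le1 z3 z3', relR x z1' u & relR u z2' z3']).

Definition assocA_low (F : frame) : Prop :=
  forall x z1 z2 z3 : W1 F,
    (exists u, relR x z1 u /\ relR u z2 z3) <->
    (exists u, relR u z1 z2 /\ relR x u z3).

Record model (F : frame) : Type := Model {
  val : nat -> set (W1 F);
  val_stable : forall i, stable (val i)
}.

Fixpoint interp (F : frame) (M : model F) (phi : form) : set (W1 F) :=
  match phi with
  | fvar i => val M i
  | ftop => [set: W1 F]
  | funit => @frU F
  | frres a b =>
      [set z | forall x v, interp M a x -> polar1 (interp M b) v -> dualT z x v]
  | fcirc a b =>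
      polard [set v | forall x z, interp M a x -> interp M b z -> dualR v x z]
  | flres b a =>
      [set x | forall z v, interp M a z -> polar1 (interp M b) v -> dualS x v z]
  end.

Definition valid_in (C : frame -> Prop) (phi psi : form) : Prop :=
  forall F : frame, C F -> forall M : model F, interp M phi `<=` interp M psi.

Definition sound_in (C : frame -> Prop) : Prop :=
  forall phi psi : form, phi |-- psi -> valid_in C phi psi.
Definition complete_in (C : frame -> Prop) : Prop :=
  forall phi psi : form, valid_in C phi psi -> phi |-- psi.

(* Main.v *)
Require Import Defs.
From mathcomp Require Import ssreflect ssrfun ssrbool boolp classical_sets.

(** Soundness: [phi ** psi] is interpreted as the Galois closure of the union
    of the sections [R x z] with [x] in [phi] and [z] in [psi], and (RES) makes
    this operation residuated, hence determined by the sections themselves; the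
    unit and association constraints are what is needed on sections. The three
    classes are increasing from [LK_low] to [LK], so only the largest matters.

    Completeness: no lattice connectives are present, so filters and ideals
    can be dispensed with. Formulas serve as points of both sorts, [x] being
    orthogonal to [y] when [x |-- y], and each of [R], [S], [T] is the section
    generated by the corresponding connective. This frame is already in
    [LK_low], the smallest class, and a formula is interpreted as the set of
    formulas that entail it. *)

Set Implicit Arguments.
Unset Strict Implicit.
Unset Printing Implicit Defensive.

Local Open Scope classical_set_scope.

(** * The Galois connection between the two sorts *)

Section Galois.
Context {F : frame}.
Implicit Types (A : set (W1 F)) (B : set (Wd F)).

Lemma polard_anti B1 B2 : B1 `<=` B2 -> polard B2 `<=` polard B1.
Proof. by move=> sB x xB y /sB; apply: xB. Qed.

Lemma sub_polard_polar1 A : A `<=` polard (polar1 A).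
Proof. by move=> x Ax y; apply. Qed.

Lemma sub_polar1_polard B : B `<=` polar1 (polard B).
Proof. by move=> y By x; apply. Qed.

Lemma stableP A : polard (polar1 A) `<=` A -> stable A.
Proof. by move=> sA; apply/seteqP; split=> //; apply: sub_polard_polar1. Qed.

Lemma polard_stable B : stable (polard B).
Proof. exact/stableP/polard_anti/sub_polar1_polard. Qed.

(** Membership in a stable set depends only on the polar of the point, and monotonically so. *)
Lemma stable_le1 A x z : stable A -> le1 x z -> A x -> A z.
Proof.
by move=> -> xz Ax y /Ax xy; apply: (xz y) => // _ ->.
Qed.

End Galois.

(** * The residuated product on stable sets *)

Section Soundness.
Context {F : frame}.
Implicit Types (A B C : set (W1 F)).

Definition circ_dual A B : set (Wd F) :=
  [set v | forall x z, A x -> B z -> dualR v x z].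
Definition circ A B : set (W1 F) := polard (circ_dual A B).

(** From left to right: every section [secR x z] with [x] in [A] and [z] in [B] lies in [circ A B],
    hence in [C]. The right-hand side is the form shared with both residuals below, so residuation
    follows by chaining. *)
Lemma sub_circ A B C : stable C ->
  circ A B `<=` C <-> polar1 C `<=` circ_dual A B.
Proof.
move=> stC; split=> [sC v Cv x z Ax Bz w wR | sC].
  by apply: Cv; apply: sC => v' Dv'; apply: (Dv' x z).
by rewrite stC; apply: polard_anti.
Qed.

Lemma sub_rres (M : model F) a b A : RES F ->
  A `<=` interp M (frres a b) <->
  polar1 (interp M b) `<=` circ_dual (interp M a) A.
Proof.
move=> res; split=> [sA v bv x z ax Az | sA z Az x v ax bv].
  by apply/(res x z v).2; apply: sA.
by apply/(res x z v).2; apply: sA.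
Qed.

Lemma sub_lres (M : model F) a b A : RES F ->
  A `<=` interp M (flres b a) <->
  polar1 (interp M b) `<=` circ_dual A (interp M a).
Proof.
move=> res; split=> [sA v bv x z Ax az | sA x Ax z v az bv].
  by apply/(res x z v).1; apply: sA.
by apply/(res x z v).1; apply: sA.
Qed.

(** A case split is enough: the residuals are intersections of polars of sections, and these are
    stable whatever the arguments are. *)
Lemma interp_stable (M : model F) phi : Ustable F -> stable (interp M phi).
Proof.
move=> stU; case: phi => [i|||b a|a b|a b] //=.
- exact: val_stable.
- exact: stableP (fun _ _ => I).
- apply: stableP => x xX z v az bv y ySvz; apply: xX => x' x'X.
  exact: (x'X z v az bv).
- exact: polard_stable.
- apply: stableP => z zX x v ax bv y yTxv; apply: zX => z' z'X.
  exact: (z'X x v ax bv).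
Qed.

(* For fixed [x] and [v], (RES) makes [dualR v x] a Galois stable condition, so
   it may be checked on the sections that generate [circ B C]. *)
Lemma dualR_circr B C x v : RES F ->
  (forall b c z, B b -> C c -> relR z b c -> dualR v x z) ->
  forall z, circ B C z -> dualR v x z.
Proof.
move=> res H z zBC; apply/(res x z v).2; apply: polard_anti zBC => y yT b c Bb Cc.
move=> u uR; have /(res x u v).2 := H b c u Bb Cc uR; exact.
Qed.

(** The mirror image: in the left argument, (RES) turns the condition into membership of [x] in the
    polar of [secS v z]. *)
Lemma dualR_circl A B z v : RES F ->
  (forall a b x, A a -> B b -> relR x a b -> dualR v x z) ->
  forall x, circ A B x -> dualR v x z.
Proof.
move=> res H x xAB; apply/(res x z v).1; apply: polard_anti xAB => y yS a b Aa Bb.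
move=> u uR; have /(res u z v).1 := H a b u Aa Bb uR; exact.
Qed.

Lemma circ_unitlE A : F21 F -> stable A -> circ (@frU F) A `<=` A.
Proof.
move=> f21 stA; apply/(sub_circ _ _ stA) => v Av x z Ux Az w wR; apply: Av.
by apply: stable_le1 Az => //; apply: f21 wR Ux.
Qed.

Lemma circ_unitrE A : F22 F -> stable A -> circ A (@frU F) `<=` A.
Proof.
move=> f22 stA; apply/(sub_circ _ _ stA) => v Av x z Ax Uz w wR; apply: Av.
by apply: stable_le1 Ax => //; apply: f22 wR Uz.
Qed.

(** If [x] were incident with some [v] in the dual of the product, (F3.1) would give a point of a
    generating section incident with [v]. *)
Lemma circ_unitlI A : F31 F -> stable A -> A `<=` circ (@frU F) A.
Proof.
move=> f31 stA x Ax v Dv /f31[z [zv [z1 [z2 [Uz1 zR xz2]]]]].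
by apply: (Dv z1 z2) zR zv => //; apply: stable_le1 Ax.
Qed.

Lemma circ_unitrI A : F32 F -> stable A -> A `<=` circ A (@frU F).
Proof.
move=> f32 stA x Ax v Dv /f32[z [zv [z1 [z2 [Uz2 zR xz1]]]]].
by apply: (Dv z1 z2) zR zv => //; apply: stable_le1 Ax.
Qed.

Lemma circ_assocl A B C : RES F -> assocA_i F ->
  stable A -> stable B -> stable C ->
  circ A (circ B C) `<=` circ (circ A B) C.
Proof.
move=> res asc stA stB stC; apply: polard_anti => v Dv x z Ax.
apply: dualR_circr => // b c {}z Bb Cc zR w wR wv.
have [|w' [w'v [v1 [c' [w'R cc' Hv1]]]]] := asc w x b c _ v wv.
  by exists z.
apply: (Dv v1 c') w'R w'v; last exact: stable_le1 Cc.
(* What remains is [circ A B v1]: a [y1] in its dual incident with [v1] would be incident with a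
   point of the section of [a'] and [b'], which lie in [A] and [B]. *)
move=> y1 Dy1 /Hv1[u [uy1 [a' [b' [uR aa' bb']]]]].
by apply: (Dy1 a' b') uR uy1; [apply: stable_le1 Ax | apply: stable_le1 Bb].
Qed.

Lemma circ_assocr A B C : RES F -> assocA_ii F ->
  stable A -> stable B -> stable C ->
  circ (circ A B) C `<=` circ A (circ B C).
Proof.
move=> res asc stA stB stC; apply: polard_anti => v Dv x c ABx Cc.
move: x ABx; apply: dualR_circl => // a b x Aa Bb xR w wR wv.
have [|w' [w'v [a' [v1 [w'R aa' Hv1]]]]] := asc w a b c _ v wv.
  by exists x.
apply: (Dv a' v1) w'R w'v; first exact: stable_le1 Aa.
move=> y1 Dy1 /Hv1[u [uy1 [b' [c' [bb' cc' uR]]]]].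
by apply: (Dy1 b' c') uR uy1; [apply: stable_le1 Bb | apply: stable_le1 Cc].
Qed.

Definition subst_model (stU : Ustable F) (M : model F) (s : nat -> form) :=
  Model (fun i => interp_stable M (s i) stU).

Lemma interp_subst (stU : Ustable F) (M : model F) s phi :
  interp M (fsubst s phi) = interp (subst_model stU M s) phi.
Proof. by elim: phi => //= [b -> a ->|a -> b ->|a -> b ->]. Qed.

End Soundness.

Lemma sound_LK : sound_in (fun F => LK F /\ assocA F).
Proof.
move=> phi psi pf F [[[_ res stU f21 f22] f31 f32] [asci ascii]].
have st M' chi := @interp_stable F M' chi stU.
(* The model stays quantified, since the substitution rule applies the induction hypothesis in
   [subst_model]. *)
elim: pf => {phi psi}.
- by move=> phi M.
- by move=> phi M.
- by move=> phi psi theta _ IH1 _ IH2 M x /IH1 /IH2.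
- by move=> s phi psi _ IH M; rewrite !(interp_subst stU); apply: IH.
- by move=> phi psi theta _ IH M; apply/(sub_lres _ _ _ _ res)/(sub_circ _ _ (st _ _))/IH.
- by move=> phi psi theta _ IH M; apply/(sub_circ _ _ (st _ _))/(sub_lres _ _ _ _ res)/IH.
- by move=> phi psi theta _ IH M; apply/(sub_rres _ _ _ _ res)/(sub_circ _ _ (st _ _))/IH.
- by move=> phi psi theta _ IH M; apply/(sub_circ _ _ (st _ _))/(sub_rres _ _ _ _ res)/IH.
- by move=> phi M; apply: circ_unitlE.
- by move=> phi M; apply: circ_unitlI.
- by move=> phi M; apply: circ_unitrE.
- by move=> phi M; apply: circ_unitrI.
- by move=> phi psi theta M; apply: circ_assocl.
- by move=> phi psi theta M; apply: circ_assocr.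
Qed.

(** * Inclusions between the classes of frames *)

Lemma LK_low_up F : LK_low F -> LK_up F.
Proof.
move=> [base f31 f32 _]; split=> // x.
  by have [z [Uz zR]] := f31 x; exists z, x; split.
by have [z [Uz zR]] := f32 x; exists x, z; split.
Qed.

Lemma LK_up_LK F : LK_up F -> LK F.
Proof. by move=> [base f31 f32]; split=> // x y xy; exists x. Qed.

Lemma assocA_low_up F : assocA_low F -> assocA_up F.
Proof.
move=> asc; split=> x z1 z2 z3.
  by move=> /asc[u [uR xR]]; exists u, z1, z2, z3; split.
move=> [u [xR uR]]; have [|v [xRv vR]] := (asc x z1 z2 z3).2.
  by exists u.
by exists v, z1, z2, z3; split.
Qed.

Lemma assocA_up_assocA F : assocA_up F -> assocA F.
Proof.
move=> [asc1 asc2]; split=> x z1 z2 z3.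
  move=> /asc1[u [z1' [z2' [z3' [le1 le2 le3 xR uR]]]]] y xy.
  exists x; split=> //; exists u, z3'; split=> // y1 uy1.
  by exists u; split=> //; exists z1', z2'.
move=> /asc2[u [z1' [z2' [z3' [le1 le2 le3 xR uR]]]]] y xy.
exists x; split=> //; exists z1', u; split=> // y1 uy1.
by exists u; split=> //; exists z2', z3'.
Qed.

Lemma sound_sub (C C' : frame -> Prop) :
  (forall F, C F -> C' F) -> sound_in C' -> sound_in C.
Proof. by move=> sC snd phi psi pf F /sC; apply: snd. Qed.

Lemma complete_sub (C C' : frame -> Prop) :
  (forall F, C F -> C' F) -> complete_in C -> complete_in C'.
Proof. by move=> sC cpl phi psi v; apply: cpl => F /sC; apply: v. Qed.

(** * The syntactic frame and completeness *)

Lemma circ_mono phi phi' psi psi' : phi |-- phi' -> psi |-- psi' ->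
  phi ** psi |-- phi' ** psi'.
Proof.
move=> h h'; apply: (@prov_cut _ (phi' ** psi)%form).
  exact/prov_lresE/(prov_cut h)/prov_lresI/prov_id.
exact/prov_rresE/(prov_cut h')/prov_rresI/prov_id.
Qed.

Lemma rres_mono phi phi' psi psi' : phi' |-- phi -> psi |-- psi' ->
  phi ~> psi |-- phi' ~> psi'.
Proof.
move=> h h'; apply: prov_rresI; apply: prov_cut h'.
apply: prov_cut (circ_mono h (prov_id _)) _.
exact/prov_rresE/prov_id.
Qed.

Lemma lres_mono phi phi' psi psi' : phi' |-- phi -> psi |-- psi' ->
  psi <~ phi |-- psi' <~ phi'.
Proof.
move=> h h'; apply: prov_lresI; apply: prov_cut h'.
apply: prov_cut (circ_mono (prov_id _) h) _.
exact/prov_lresE/prov_id.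
Qed.

Definition syntactic_frame : frame := {|
  W1 := form; Wd := form;
  W1_nonempty := inhabits ftop; Wd_nonempty := inhabits ftop;
  inc x y := ~ (x |-- y);
  frU := [set x | x |-- funit];
  relS y v x := v <~ x |-- y;
  relR x u w := x |-- u ** w;
  relT y x v := x ~> v |-- y
|}.

Local Notation SF := syntactic_frame.

Lemma syn_perp (x y : form) : @perp SF x y = (x |-- y).
Proof. by rewrite /perp /= notK. Qed.

Lemma syn_polar1 (a : form) :
  @polar1 SF [set x | x |-- a] = [set y | a |-- y].
Proof.
apply/seteqP; split=> y /= H.
  by have := H a (prov_id a); rewrite syn_perp.
by move=> x xa; rewrite syn_perp; apply: prov_cut xa H.
Qed.

Lemma syn_polard (a : form) :
  @polard SF [set y | a |-- y] = [set x | x |-- a].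
Proof.
apply/seteqP; split=> x /= H.
  by have := H a (prov_id a); rewrite syn_perp.
by move=> y ay; rewrite syn_perp; apply: prov_cut H ay.
Qed.

(** The polar of [a] consists of its consequences, so stronger formulas are higher. On the second
    sort the polar consists of the formulas entailing [a], and the direction flips. *)
Lemma syn_le1 (a b : form) : @le1 SF a b <-> b |-- a.
Proof.
split=> [ab | ba y ay _ ->].
  have := ab a; rewrite /polar1 /= => /(_ _ b erefl); rewrite syn_perp; apply.
  by move=> _ ->; rewrite syn_perp; apply: prov_id.
by have := ay a erefl; rewrite !syn_perp; apply: prov_cut.
Qed.

Lemma syn_led (a b : form) : @led SF a b <-> a |-- b.
Proof.
split=> [ab | ba x xa _ ->].
  have := ab a; rewrite /polard /= => /(_ _ b erefl); rewrite syn_perp; apply.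
  by move=> _ ->; rewrite syn_perp; apply: prov_id.
by have := xa a erefl; rewrite !syn_perp => /prov_cut; apply.
Qed.

Lemma syn_dualS (x v z : form) : @dualS SF x v z = (x |-- v <~ z).
Proof. by rewrite /dualS /secS /= syn_polard. Qed.

Lemma syn_dualR (v x z : form) : @dualR SF v x z = (x ** z |-- v).
Proof. by rewrite /dualR /secR /= syn_polar1. Qed.

Lemma syn_dualT (z x v : form) : @dualT SF z x v = (z |-- x ~> v).
Proof. by rewrite /dualT /secT /= syn_polard. Qed.

Lemma syn_stable (a : form) : @stable SF [set x | x |-- a].
Proof. by rewrite /stable syn_polar1 syn_polard. Qed.

Lemma syn_costable (a : form) : @costable SF [set y | a |-- y].
Proof. by rewrite /costable syn_polard syn_polar1. Qed.

(** Once the dual relations are computed, (RES) is exactly the residuation rules; (F2.1) and (F2.2)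
    come from the unit rules. *)
Lemma syn_LKbase : LKbase SF.
Proof.
split.
- by split=> *; [apply: syn_costable | apply: syn_stable | apply: syn_costable].
- move=> x z v; rewrite syn_dualS syn_dualR syn_dualT.
  by split; split=> ?; [apply: prov_lresE | apply: prov_lresI
                       | apply: prov_rresI | apply: prov_rresE].
- exact: syn_stable.
- move=> x z1 z2 xR Uz1; apply/syn_le1/(prov_cut xR).
  exact: prov_cut (circ_mono Uz1 (prov_id _)) (prov_unitlE _).
- move=> x z1 z2 xR Uz2; apply/syn_le1/(prov_cut xR).
  exact: prov_cut (circ_mono (prov_id _) Uz2) (prov_unitrE _).
Qed.

Lemma syn_monM : monM SF.
Proof.
split=> y; split=> a b c /=.
- by move=> /syn_le1 ba; exact: prov_cut (rres_mono ba (prov_id _)).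
- by move=> /syn_led cb; exact: prov_cut (rres_mono (prov_id _) cb).
- by move=> /syn_le1 ba /prov_cut; apply; exact: circ_mono ba (prov_id _).
- by move=> /syn_le1 cb /prov_cut; apply; exact: circ_mono (prov_id _) cb.
- by move=> /syn_led ba; exact: prov_cut (lres_mono (prov_id _) ba).
- by move=> /syn_le1 cb; exact: prov_cut (lres_mono cb (prov_id _)).
Qed.

Lemma syn_LK_low : LK_low SF.
Proof.
split; [exact: syn_LKbase | | | exact: syn_monM] => x; exists funit.
  by split; [apply: prov_id | apply: prov_unitlI].
by split; [apply: prov_id | apply: prov_unitrI].
Qed.

Lemma syn_assocA_low : assocA_low SF.
Proof.
move=> x z1 z2 z3; split=> [[u [/= xR uR]] | [u [/= uR xR]]].
  (* The witness is the formula that generates the section of [z1] and [z2]. *)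
  exists (z1 ** z2)%form; split; first exact: prov_id.
  apply: prov_cut xR _.
  exact: prov_cut (circ_mono (prov_id _) uR) (prov_assocl _ _ _).
exists (z2 ** z3)%form; split; last exact: prov_id.
apply: prov_cut xR _.
exact: prov_cut (circ_mono uR (prov_id _)) (prov_assocr _ _ _).
Qed.

Definition syn_model : model SF := Model (fun i => syn_stable (fvar i)).

(** By induction the arguments are principal. The quantified condition for each connective is then
    instantiated at the generators [a] and [b], and recovered from that instance by monotonicity. *)
Lemma syn_interp (phi : form) : interp syn_model phi = [set x | x |-- phi].
Proof.
elim: phi => [i|||b IHb a IHa|a IHa b IHb|a IHa b IHb] //=.
- by apply/seteqP; split=> x _ //; apply: prov_top.
- rewrite IHa IHb syn_polar1; apply/seteqP; split=> x /= H.
    by rewrite -syn_dualS; apply: H; apply: prov_id.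
  move=> z v za bv; rewrite syn_dualS; apply: prov_cut H _.
  exact: lres_mono.
- rewrite IHa IHb -(syn_polard (a ** b)); congr (@polard SF _); apply/seteqP; split=> v /= H.
    by rewrite -syn_dualR; apply: H; apply: prov_id.
  move=> x z xa zb; rewrite syn_dualR; apply: prov_cut H.
  exact: circ_mono.
- rewrite IHa IHb syn_polar1; apply/seteqP; split=> z /= H.
    by rewrite -syn_dualT; apply: H; apply: prov_id.
  move=> x v xa bv; rewrite syn_dualT; apply: prov_cut H _.
  exact: rres_mono.
Qed.

Lemma complete_LK_low : complete_in (fun F => LK_low F /\ assocA_low F).
Proof.
move=> phi psi /(_ SF (conj syn_LK_low syn_assocA_low) syn_model).
(* [phi] belongs to its own interpretation, hence to that of [psi]. *)
by rewrite !syn_interp; apply; apply: prov_id.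
Qed.

Theorem theorem4p2 :
  [/\ sound_in (fun F => LK F /\ assocA F),
      sound_in (fun F => LK_up F /\ assocA_up F)
    & sound_in (fun F => LK_low F /\ assocA_low F)]
  /\
  [/\ complete_in (fun F => LK_low F /\ assocA_low F),
      complete_in (fun F => LK_up F /\ assocA_up F)
    & complete_in (fun F => LK F /\ assocA F)].
Proof.
have low_up F : LK_low F /\ assocA_low F -> LK_up F /\ assocA_up F.
  by move=> [/LK_low_up ? /assocA_low_up ?].
have up_LK F : LK_up F /\ assocA_up F -> LK F /\ assocA F.
  by move=> [/LK_up_LK ? /assocA_up_assocA ?].
have sound_up := sound_sub up_LK sound_LK.
have complete_up := complete_sub low_up complete_LK_low.
split; split=> //; first exact: sound_LK.
- exact: sound_sub low_up sound_up.
- exact: complete_LK_low.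
- exact: complete_sub up_LK complete_up.
Qed.
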